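(* Let $G\ncong K_n$ be a connected graph on $n$ vertices with chromatic number $\chi$. Then $$m_{D^{L}(G)}\left(n,\,n+\left\lceil\frac{n}{\chi}\right\rceil\right)\leq n-\left\lceil\frac{n}{\chi}\right\rceil-C_{\overline{G}}+1,$$ where $C_{\overline{G}}$ is the number of connected components of the complement $\overline{G}$ of $G$. The bound is best possible for $\chi=2$ (when $n$ is odd) and for $\chi=n-1$: equality holds for the complete bipartite graph $K_{m+1,m}$, where $n=2m+1$, and for the complete multipartite graph $K_{2,1,1,\dots,1}$ with one part of size $2$ and $n-2$ parts of size $1$, respectively.
   Context: All graphs are finite, simple and connected (except that complements may be disconnected). For a connected graph $G$ with vertex set $\{v_1,\dots,v_n\}$, $d_{uv}$ is the length of a shortest path between $u$ and $v$, $D(G)=(d_{uv})$ is the distance matrix, $Tr(v)=\sum_{u\in V(G)}d_{uv}$ is the transmission of $v$, and the distance Laplacian matrix is $D^L(G)=\mathrm{diag}(Tr(v_1),\dots,Tr(v_n))-D(G)$. Its eigenvalues (all real) are the distance Laplacian eigenvalues of $G$. For an interval $I\subseteq\mathbb{R}$, $m_{D^L(G)}I$ denotes the number of distance Laplacian eigenvalues of $G$, counted with multiplicity, lying in $I$. $K_n$ is the complete graph on $n$ vertices. *)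

(* Defs.v *)
From HB Require Import structures.
From mathcomp Require Import all_boot all_order all_algebra.
From mathcomp Require Import polyrcf reals.

Set Implicit Arguments.
Unset Strict Implicit.
Unset Printing Implicit Defensive.

Import Order.TTheory GRing.Theory Num.Theory.

Local Open Scope nat_scope.

Record sgraph := SGraph {
  vertex :> finType;
  adj : rel vertex;
  adj_sym : symmetric adj;
  adj_irrefl : irreflexive adj }.

Definition graph_iso (G H : sgraph) : Prop :=
  exists2 f : G -> H, bijective f & forall x y, adj (f x) (f y) = adj x y.

Definition connected_graph (G : sgraph) : Prop :=
  0 < #|G| /\ forall x y : G, connect (@adj G) x y.

Section Complement.
Variable G : sgraph.

Definition compl_adj : rel G := fun x y => (x != y) && ~~ adj x y.

Fact compl_adj_sym : symmetric compl_adj.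
Proof. by move=> x y; rewrite /compl_adj eq_sym adj_sym. Qed.

Fact compl_adj_irrefl : irreflexive compl_adj.
Proof. by move=> x; rewrite /compl_adj eqxx. Qed.

Definition compl_graph : sgraph := SGraph compl_adj_sym compl_adj_irrefl.

End Complement.

Definition num_components (G : sgraph) : nat := n_comp (@adj G) predT.

Section Complete.
Variable n : nat.

Definition complete_adj : rel 'I_n := fun x y => x != y.

Fact complete_adj_sym : symmetric complete_adj.
Proof. by move=> x y; rewrite /complete_adj eq_sym. Qed.

Fact complete_adj_irrefl : irreflexive complete_adj.
Proof. by move=> x; rewrite /complete_adj eqxx. Qed.

Definition complete_graph : sgraph :=
  SGraph complete_adj_sym complete_adj_irrefl.

End Complete.

(* [s] lists the sizes of the parts; the vertex [Tagged _ j] with tag [i] is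
   the [j]-th vertex of the [i]-th part. *)
Section CompleteMultipartite.
Variable s : seq nat.

Definition cm_vertex : finType := {i : 'I_(size s) & 'I_(nth 0 s i)}.

Definition cm_adj : rel cm_vertex := fun u v => tag u != tag v.

Fact cm_adj_sym : symmetric cm_adj.
Proof. by move=> u v; rewrite /cm_adj eq_sym. Qed.

Fact cm_adj_irrefl : irreflexive cm_adj.
Proof. by move=> u; rewrite /cm_adj eqxx. Qed.

Definition complete_multipartite : sgraph := SGraph cm_adj_sym cm_adj_irrefl.

End CompleteMultipartite.

Section Chromatic.
Variable G : sgraph.

Definition proper_coloring k (c : {ffun G -> 'I_k}) : bool :=
  [forall x, forall y, adj x y ==> (c x != c y)].

Definition colorable (k : nat) : bool :=
  [exists c : {ffun G -> 'I_k}, proper_coloring c].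

Fact colorable_exists : exists k, colorable k.
Proof.
exists #|G|; apply/existsP; exists [ffun x => enum_rank x].
apply/forallP=> x; apply/forallP=> y; apply/implyP=> xy; rewrite !ffunE.
by apply: contraTneq xy => /enum_rank_inj->; rewrite adj_irrefl.
Qed.

Definition chromatic_number : nat := ex_minn colorable_exists.

End Chromatic.

Section Distance.
Variable G : sgraph.

Definition has_path (u v : G) (k : nat) : bool :=
  [exists p : k.-tuple G,
     [&& path (@adj G) u p, last u p == v & uniq (u :: p)]].

(* A path of [G] has fewer than [#|G|] edges, so it is enough to search the
   lengths below [#|G|]; for [u] and [v] in different components the value is
   the junk [#|G|]. *)
Definition dist (u v : G) : nat := find (has_path u v) (iota 0 #|G|).

Definition transmission (v : G) : nat := \sum_(u : G) dist u v.

End Distance.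

Local Open Scope ring_scope.

Section DistanceLaplacian.
Variables (R : realType) (G : sgraph).

Definition dist_mx : 'M[R]_#|G| :=
  \matrix_(i, j) (dist (enum_val i) (enum_val j))%:R.

Definition transmission_mx : 'M[R]_#|G| :=
  diag_mx (\row_i (transmission (enum_val i))%:R).

Definition dist_laplacian : 'M[R]_#|G| := transmission_mx - dist_mx.

(* [rootsR p] lists the distinct roots of [p] in [R], and [mup x p] is the
   multiplicity of [x] as a root of [p]. *)
Definition mDL (I : interval R) : nat :=
  let p := char_poly dist_laplacian in
  (\sum_(x <- rootsR p | x \in I) mup x p)%N.

Definition ceil_n_chi : int :=
  Num.ceil (#|G|%:R / (chromatic_number G)%:R : R).

End DistanceLaplacian.

(* Main.v *)
(* Every distance off the diagonal is at least 1, and at least 2 between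
   non-adjacent vertices, so the distance Laplacian has the form
   n |x|^2 - |sum x|^2 + (weighted Laplacian form of the complement), with
   weights d(u, v) - 1 >= 1 on the edges of the complement.
   On vectors constant on the components of the complement the form is at most
   n |x|^2, so at least C eigenvalues are <= n.  On vectors with zero sum that
   are supported on an independent set of size s the form is at least
   (n + s) |x|^2, because the complement contains a clique of size s; so at
   least s - 1 eigenvalues are >= n + s.  Some color class has size
   s >= ceil (n / chi), and the eigenvalues strictly between n and
   n + ceil (n / chi) are among the remaining n - C - (s - 1).  For
   K_{2,1,...,1} the bound is 0; for K_{m+1,m} it is attained through the
   eigenvalue n + m of multiplicity m - 1. *)

Require Import Defs.
From HB Require Import structures.
From mathcomp Require Import all_boot all_order all_algebra.
From mathcomp Require Import complex polyrcf reals.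
From mathcomp Require Import zify ring.

Set Implicit Arguments.
Unset Strict Implicit.
Unset Printing Implicit Defensive.

Import Order.TTheory GRing.Theory Num.Theory.

Local Open Scope ring_scope.
Local Open Scope sesquilinear_scope.
Local Open Scope complex_scope.

(** * Linear systems, root counting and the spectral theorem *)

Lemma nontrivial_solution (F : fieldType) (I : finType) (n : nat)
    (f : I -> 'I_n -> F) :
  (#|I| < n)%N ->
  exists2 x : 'rV[F]_n, x != 0 & forall i, \sum_j f i j * x 0 j = 0.
Proof.
move=> ltIn; pose M : 'M[F]_(n, #|I|) := \matrix_(j, i) f (enum_val i) j.
have kerM0 : kermx M != 0.
  rewrite -mxrank_eq0 mxrank_ker subn_eq0 -ltnNge.
  exact: leq_ltn_trans (rank_leq_col M) ltIn.
exists (nz_row (kermx M)); first by rewrite nz_row_eq0.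
move=> i; have /sub_kermxP/rowP/(_ (enum_rank i)) := nz_row_sub (kermx M).
rewrite !mxE => eq0; rewrite -[RHS]eq0; apply: eq_bigr => j _.
by rewrite !mxE enum_rankK mulrC.
Qed.

(** Turns [mDL] into a count of indices: after exchanging the sums, each [i] contributes once, at
    the root [x = r i], provided that it lies in [J]. *)
Lemma sum_mup_rootsR (R : realType) n (r : 'I_n -> R) (J : interval R) :
  let p := \prod_i ('X - (r i)%:P) in
  (\sum_(x <- rootsR p | x \in J) mup x p)%N = #|[pred i | r i \in J]|.
Proof.
move=> p.
have p0 : p != 0 by apply/prodf_neq0 => i _; rewrite polyXsubC_eq0.
have mupE x : mup x p = (\sum_i (r i == x))%N.
  (* Nonvanishing is carried through the induction because multiplicities add only over nonzero
     factors. *)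
  suff [] : p != 0 /\ mup x p = (\sum_i (r i == x))%N by [].
  rewrite {p0}/p; elim/big_rec2: _ => [|i k q _ [q0 <-]].
    by rewrite oner_eq0 mupNroot // rootC oner_eq0.
  rewrite mulf_neq0 ?mupM ?polyXsubC_eq0 //.
  by rewrite -['X - _]expr1 mup_XsubCX; case: eqP.
have rootE x : (x \in rootsR p) = root p x.
  by have := roots_on_rootsR p0 x; rewrite in_itv /= => ->.
under eq_bigr do rewrite mupE.
rewrite exchange_big -sum1_card [RHS]big_mkcond; apply: eq_bigr => i _ /=.
rewrite inE big_mkcond /=.
have ri : r i \in rootsR p.
  by rewrite rootE /root horner_prod (bigD1 i) //= hornerXsubC subrr mul0r.
rewrite (bigD1_seq (r i)) ?uniq_roots //= eqxx big1 ?addn0; first by case: ifP.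
by move=> x /negPf xr; rewrite eq_sym xr; case: ifP.
Qed.

Lemma char_poly_conj (F : fieldType) n (P A : 'M[F]_n) : P \in unitmx ->
  char_poly (invmx P *m A *m P) = char_poly A.
Proof.
move=> unitP; rewrite /char_poly.
have -> : char_poly_mx (invmx P *m A *m P) =
    map_mx polyC (invmx P) *m char_poly_mx A *m map_mx polyC P.
  rewrite /char_poly_mx mulmxBr mulmxBl -!map_mxM; congr (_ - _).
  by rewrite scalar_mxC -mulmxA -map_mxM mulVmx // map_mx1 mulmx1.
by rewrite !det_mulmx mulrAC -det_mulmx -map_mxM mulVmx // map_mx1 det1 mul1r.
Qed.

(** Over [R[i]] the matrix is Hermitian, hence unitarily diagonalizable with real eigenvalues; the
    factorization of the characteristic polynomial descends to [R] because the embedding is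
    injective on polynomials. *)
Lemma symmetric_spectral (R : realType) n (A : 'M[R]_n) : A^T = A ->
  exists r : 'I_n -> R, exists P : 'M[R[i]]_n,
    [/\ P \is unitarymx,
        map_mx (real_complex R) A = P^t* *m diag_mx (\row_i (r i)%:C) *m P
      & char_poly A = \prod_i ('X - (r i)%:P)].
Proof.
move=> symA; pose A' := map_mx (real_complex R) A.
have realC (x : R) : (x%:C)^*%R = x%:C.
  by apply/CrealP; rewrite complex_real.
have hermA : A' \is hermsymmx.
  apply/is_hermitianmxP; rewrite expr0 scale1r /A' -{1}symA.
  by apply/matrixP => i j; rewrite !mxE realC.
have /mxOverP dreal := hermitian_spectral_diag_real hermA.
have /hermitian_normalmx/orthomx_spectralP := hermA.
have := spectral_unitarymx A'.
move: (spectralmx A') (spectral_diag A') dreal => P d dreal unitP.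
rewrite invmx_unitary // => defA.
have dE : d = \row_i (complex.Re (d 0 i))%:C.
  by apply/rowP=> i; rewrite mxE RRe_real.
exists (fun i => complex.Re (d 0 i)), P; split=> //; first by rewrite -dE.
apply: (map_poly_inj (real_complex R)).
rewrite map_char_poly -/A' defA rmorph_prod /=.
under [RHS]eq_bigr do rewrite map_polyXsubC /= RRe_real //.
rewrite -invmx_unitary // char_poly_conj ?unitarymx_unit //.
rewrite char_poly_trig ?diag_mx_is_trig //; apply: eq_bigr => i _.
by rewrite mxE eqxx.
Qed.

(** * Eigenvalue counts on subspaces cut out by linear conditions *)

Section SpectralCounting.
Variables (R : realType) (n : nat) (A : 'M[R]_n) (P : 'M[R[i]]_n).
Variable r : 'I_n -> R.
Hypothesis unitP : P \is unitarymx.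
Hypothesis defA :
  map_mx (real_complex R) A = P^t* *m diag_mx (\row_i (r i)%:C) *m P.
Variables (I : finType) (f : I -> 'I_n -> R[i]).

Let mulPtP : P^t* *m P = 1%:M.
Proof. by rewrite -invmx_unitary // mulVmx ?unitarymx_unit. Qed.

(** A dimension count in place of a min-max principle: were the bound false, some nonzero [x] would
    satisfy the [#|I|] conditions and have all its eigenbasis coordinates in [Q] equal to zero. *)
Lemma card_spectral_coordinates (Q : pred 'I_n) :
    (forall x : 'rV_n, x != 0 -> (forall i, \sum_j f i j * x 0 j = 0) ->
       exists2 j, Q j & (x *m P^t*) 0 j != 0) ->
  (n <= #|I| + #|Q|)%N.
Proof.
move=> hitQ; rewrite leqNgt; apply/negP => ltn.
pose g (k : I + {j | Q j}) j :=
  match k with inl i => f i j | inr q => P^t* j (val q) end.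
have [|x x0 gx0] := @nontrivial_solution _ _ n g.
  by rewrite card_sum card_sig.
have [|j Qj] := hitQ x x0; first by move=> i; exact: gx0 (inl i).
move=> /negP; apply; rewrite mxE; apply/eqP.
rewrite -[RHS](gx0 (inr (exist _ j Qj))); apply: eq_bigr => k _.
exact: mulrC.
Qed.

(** In the eigenbasis, an eigenvector for [c] has nonzero coordinates only at indices [j] with
    [r j = c]. *)
Lemma card_eigenvalue (c : R) :
    (forall x : 'rV_n, (forall i, \sum_j f i j * x 0 j = 0) ->
       x *m map_mx (real_complex R) A = c%:C *: x) ->
  (n <= #|I| + #|[pred i | r i == c]|)%N.
Proof.
move=> eigx; apply: card_spectral_coordinates => x x0 /eigx.
rewrite defA -!mulmxA => /(congr1 (mulmx^~ (P^t*))).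
rewrite -!mulmxA (unitarymxP unitP) mulmx1 -scalemxAl => xDP.
have [j yj0] : exists j, (x *m P^t*) 0 j != 0.
  apply/existsP; apply: contraNT x0 => /existsPn y0.
  rewrite -[x]mulmx1 -mulPtP mulmxA; apply/eqP.
  suff -> : x *m P^t* = 0 by rewrite mul0mx.
  by apply/rowP=> j; rewrite [RHS]mxE; apply/eqP/negPn/y0.
exists j => //; move/rowP/(_ j): xDP; rewrite mulmxA mul_mx_diag.
rewrite [LHS]mxE [in RHS]mxE [in X in _ * X]mxE mulrC => /(mulIf yj0).
by move=> /complexI rj; rewrite /= rj.
Qed.

(** In eigenbasis coordinates [y] the form is the sum of the [(e * r j + c) * |y j|^2]. If [y]
    vanished wherever the coefficient is nonnegative, a nonnegative sum of nonpositive terms would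
    force [y = 0]. Taking [e] to be 1 or -1 yields counts of large or of small eigenvalues. *)
Lemma card_nonneg_form (e c : R) :
    (forall x : 'rV_n, (forall i, \sum_j f i j * x 0 j = 0) ->
       0 <= e%:C * (x *m map_mx (real_complex R) A *m x^t*) 0 0
            + c%:C * (x *m x^t*) 0 0) ->
  (n <= #|I| + #|[pred i | (0 <= e * r i + c)%R]|)%N.
Proof.
move=> posx; apply: card_spectral_coordinates => x x0 /posx.
set y := x *m P^t*.
have -> : x *m x^t* = y *m y^t*.
  by rewrite trmx_mul map_mxM trmxCK !mulmxA -(mulmxA x) mulPtP mulmx1.
have -> : x *m map_mx (real_complex R) A *m x^t*
    = y *m diag_mx (\row_i (r i)%:C) *m y^t*.
  by rewrite defA trmx_mul map_mxM trmxCK !mulmxA.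
rewrite mul_mx_diag !mxE !mulr_sumr -big_split /=.
rewrite (eq_bigr (fun j => (e * r j + c)%:C * `|y 0 j| ^+ 2)) => [sum_ge0|j _].
  2: by rewrite !mxE normCK rmorphD rmorphM /=; ring.
apply/exists_inP; apply: contraNT x0 => /exists_inPn y0.
have term_le0 j : (e * r j + c)%:C * `|y 0 j| ^+ 2 <= 0.
  have [/y0/negPn/eqP->|] := boolP (0 <= e * r j + c).
    by rewrite normr0 expr0n mulr0.
  rewrite -ltNge => /ltW neg; rewrite mulr_le0_ge0 ?exprn_ge0 //.
  by rewrite lecR.
have y_eq0 : y = 0.
  apply/rowP=> j; rewrite [RHS]mxE; apply/eqP.
  have [/y0/negPn //|neg] := boolP (0 <= e * r j + c).
  have opp_ge0 k : true -> 0 <= - ((e * r k + c)%:C * `|y 0 k| ^+ 2).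
    by rewrite oppr_ge0.
  have : \sum_j - ((e * r j + c)%:C * `|y 0 j| ^+ 2) = 0.
    apply/le_anti/andP; split; last by apply: sumr_ge0 => k _; rewrite oppr_ge0.
    by rewrite sumrN oppr_le0.
  move/(psumr_eq0P opp_ge0)/(_ j isT)/eqP.
  rewrite oppr_eq0 mulf_eq0 expf_eq0 /= normr_eq0 => /orP[|//].
  rewrite (inj_eq (@complexI _)) => /eqP eq0.
  by rewrite eq0 lexx in neg.
by rewrite -[x]mulmx1 -mulPtP mulmxA -/y y_eq0 mul0mx.
Qed.

End SpectralCounting.

(** * Distances 0, 1 and 2 *)

Section Distance.
Variable G : sgraph.

Lemma has_path_sym (u v : G) k : has_path u v k -> has_path v u k.
Proof.
case/existsP=> p /and3P[pth /eqP lst unq]; apply/existsP.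
have sz : size (rev (belast u p)) == k.
  by rewrite size_rev size_belast size_tuple.
exists (Tuple sz); apply/and3P; split.
- rewrite -lst rev_path (eq_path (e' := @adj G)) // => x y; exact: adj_sym.
- rewrite /=; case: (tval p) lst => [<-|a s _] /=; first exact: eqxx.
  by rewrite rev_cons last_rcons.
- by rewrite -lst -rev_rcons -lastI rev_uniq.
Qed.

Lemma dist_sym (u v : G) : dist u v = dist v u.
Proof. by apply: eq_find => k; apply/idP/idP; exact: has_path_sym. Qed.

Lemma has_path0 (u v : G) : has_path u v 0 = (u == v).
Proof.
apply/existsP/eqP => [[p]|->]; first by rewrite tuple0 /= andbT => /eqP.
by exists [tuple]; rewrite /= eqxx.
Qed.

Lemma has_path1 (u v : G) : has_path u v 1 = adj u v.
Proof.
apply/existsP/idP => [[p]|uv].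
  case: p => [[|a [|b s]] //= _].
  by rewrite andbT => /and3P[ua /eqP <-].
exists [tuple v]; rewrite /= uv eqxx !andbT inE.
by apply: contraTneq uv => ->; rewrite adj_irrefl.
Qed.

Lemma dist_refl (u : G) : dist u u = 0%N.
Proof.
rewrite /dist; have : (0 < #|G|)%N by apply/card_gt0P; exists u.
by case: #|G| => //= n _; rewrite has_path0 eqxx.
Qed.

Lemma distE (u v : G) : u != v ->
  dist u v =
    (if adj u v then 1 else (find (has_path u v) (iota 2 (#|G| - 2))).+2)%N.
Proof.
move=> uv; have : (1 < #|G|)%N.
  by apply: leq_trans (max_card (pred2 u v)); rewrite card2 uv.
rewrite /dist; case: #|G| => [|[|n]] //= _.
by rewrite has_path0 has_path1 (negPf uv) subn2 /=; case: ifP.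
Qed.

Lemma dist_adj (u v : G) : adj u v -> dist u v = 1%N.
Proof.
move=> uv; rewrite distE ?uv //.
by apply: contraTneq uv => ->; rewrite adj_irrefl.
Qed.

Lemma dist_ge1 (u v : G) : u != v -> (1 <= dist u v)%N.
Proof. by move=> /distE ->; case: ifP. Qed.

Lemma dist_ge2 (u v : G) : u != v -> ~~ adj u v -> (2 <= dist u v)%N.
Proof. by move=> /distE -> /negPf ->. Qed.

Lemma dist_common_neighbor (u v w : G) :
  u != v -> ~~ adj u v -> adj u w -> adj w v -> dist u v = 2%N.
Proof.
move=> uv nuv uw wv; rewrite distE // (negPf nuv).
have neq x y : adj x y -> x != y :> G.
  by move=> xy; apply: contraTneq xy => ->; rewrite adj_irrefl.
have path2 : has_path u v 2.
  apply/existsP; exists [tuple w; v] => /=.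
  by rewrite uw wv eqxx !inE negb_or uv !neq.
(* Three distinct vertices put the length 2 inside the range that [dist] searches. *)
have : (2 < #|G|)%N.
  apply: leq_trans (max_card (mem [:: u; v; w])).
  by rewrite (card_uniqP _) //= !inE negb_or uv [v == w]eq_sym !neq.
by case: #|G| => [|[|[|n]]] //= _; rewrite path2.
Qed.

End Distance.

(** * The quadratic form of the distance Laplacian *)

Section DistanceLaplacianForm.
Variables (R : realType) (G : sgraph).
Let L := map_mx (real_complex R) (dist_laplacian R G).

Lemma dist_laplacian_sym : (dist_laplacian R G)^T = dist_laplacian R G.
Proof.
apply/matrixP=> i j; rewrite !mxE dist_sym eq_sym.
by case: eqP => // ->.
Qed.

Lemma dist_laplacian_row (x : 'rV[R[i]]_#|G|) (u : G) :
  (x *m L) 0 (enum_rank u) =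
  \sum_v (dist u v)%:R * (x 0 (enum_rank u) - x 0 (enum_rank v)).
Proof.
rewrite mxE (reindex enum_rank) /=; last exact/onW_bij/enum_rank_bij.
under eq_bigr => v _.
  rewrite !mxE !enum_rankK (inj_eq enum_rank_inj).
  rewrite rmorphB rmorphMn /= mulrBr !rmorph_nat.
over.
rewrite big_split /= sumrN (bigD1 u) //= eqxx mulr1n big1 ?addr0; last first.
  by move=> v /negPf ->; rewrite mulr0n mulr0.
rewrite /transmission natr_sum mulr_sumr -sumrB; apply: eq_bigr => v _.
by rewrite (dist_sym v) mulrBr ![_ * x 0 _]mulrC.
Qed.

(** Doubled because the sum runs over ordered pairs: adding the copy with [u] and [v] exchanged
    completes each term to a squared modulus. *)
Lemma dist_laplacian_form (x : 'rV[R[i]]_#|G|) :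
  (x *m L *m x^t*) 0 0 *+ 2 =
  \sum_u \sum_v
    (dist u v)%:R * `|x 0 (enum_rank u) - x 0 (enum_rank v)| ^+ 2.
Proof.
set z := fun u => x 0 (enum_rank u).
have formE : (x *m L *m x^t*) 0 0 =
    \sum_u \sum_v (dist u v)%:R * ((z u - z v) * (z u)^*%R).
  rewrite mxE (reindex enum_rank) /=; last exact/onW_bij/enum_rank_bij.
  apply: eq_bigr => u _; rewrite dist_laplacian_row !mxE mulr_suml.
  by apply: eq_bigr => v _; rewrite mulrA.
rewrite mulr2n formE [X in X + _]exchange_big -big_split; apply: eq_bigr => v _.
rewrite -big_split; apply: eq_bigr => u _ /=; rewrite dist_sym normCK.
rewrite -mulrDr rmorphB /=; congr (_ * _); rewrite -/(z u) -/(z v).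
by ring.
Qed.

Lemma sqnorm_enum_rank (x : 'rV[R[i]]_#|G|) :
  (x *m x^t*) 0 0 = \sum_u `|x 0 (enum_rank u)| ^+ 2.
Proof.
rewrite mxE (reindex enum_rank) /=; last exact/onW_bij/enum_rank_bij.
by apply: eq_bigr => u _; rewrite normCK !mxE.
Qed.

End DistanceLaplacianForm.

(** Twice the Laplacian form of a clique on [D]. It is used for the complete graph on all vertices
    and for the clique that an independent set spans in the complement. *)
Lemma sum_sqr_diff (C : numClosedFieldType) (T : finType) (D : pred T)
    (z : T -> C) :
  \sum_(u | D u) \sum_(v | D v) `|z u - z v| ^+ 2 =
  #|D|%:R * (\sum_(u | D u) `|z u| ^+ 2) *+ 2 - `|\sum_(u | D u) z u| ^+ 2 *+ 2.
Proof.
have -> : `|\sum_(u | D u) z u| ^+ 2 =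
    \sum_(u | D u) \sum_(v | D v) z u * (z v)^*.
  rewrite normCK rmorph_sum mulr_suml; apply: eq_bigr => u _.
  by rewrite mulr_sumr.
rewrite mulr2n [X in _ - X]mulr2n [in X in _ - (_ + X)]exchange_big /=.
under [X in _ - (_ + X)]eq_bigr do under eq_bigr do rewrite mulrC.
have cstE F : #|D|%:R * (\sum_(u | D u) F u) =
    \sum_(u | D u) \sum_(v | D v) F u :> C.
  rewrite mulr_sumr; apply: eq_bigr => u _.
  by rewrite sumr_const mulr_natl.
rewrite {1}cstE cstE [X in _ + X - _]exchange_big /=.
rewrite -!big_split -sumrB; apply: eq_bigr => u _.
rewrite -!big_split -sumrB; apply: eq_bigr => v _ /=.
rewrite !normCK rmorphB; ring.
Qed.

Lemma dist_laplacian_spectral (R : realType) (G : sgraph) :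
  exists r : 'I_#|G| -> R, exists P : 'M[R[i]]_#|G|,
    [/\ P \is unitarymx,
        map_mx (real_complex R) (dist_laplacian R G) =
          P^t* *m diag_mx (\row_i (r i)%:C) *m P
      & forall J : interval R, mDL G J = #|[pred i | r i \in J]|].
Proof.
have [r [P [unitP defL charL]]] := symmetric_spectral (dist_laplacian_sym R G).
exists r, P; split=> // J.
by rewrite /mDL charL sum_mup_rootsR.
Qed.

Lemma sum_delta_row (F : pzRingType) n (a : 'I_n) (x : 'rV[F]_n) :
  \sum_j (j == a)%:R * x 0 j = x 0 a.
Proof.
rewrite (bigD1 a) //= eqxx mul1r big1 ?addr0 // => j /negPf ->.
by rewrite mul0r.
Qed.

Section ZeroSum.
Variables (F : nzRingType) (G : sgraph) (D : pred G).

(* The linear conditions cutting out the vectors that are supported on [D] and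
   have zero sum. *)
Definition zero_sum_on (k : option {v : G | ~~ D v}) (j : 'I_#|G|) : F :=
  if k is Some w then (j == enum_rank (val w))%:R else 1.

(** One condition per vertex outside [D] and one for the sum, which leaves dimension at least
    [#|D| - 1]. *)
Lemma card_zero_sum_on : (#|{: option {v : G | ~~ D v}}| + #|D| = #|G| + 1)%N.
Proof.
rewrite card_option card_sig addSn addnC -addn1; congr (_ + 1)%N.
by rewrite -[RHS](cardC D); congr addn; exact: eq_card.
Qed.

Lemma zero_sum_onP (x : 'rV[F]_#|G|) :
    (forall k, \sum_j zero_sum_on k j * x 0 j = 0) ->
  (forall v, ~~ D v -> x 0 (enum_rank v) = 0) /\
  \sum_v x 0 (enum_rank v) = 0.
Proof.
move=> fx0; split=> [v Dv|].
  by rewrite -(fx0 (Some (exist _ v Dv))) /= sum_delta_row.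
rewrite -[RHS](fx0 None) [RHS](reindex enum_rank) /=; last first.
  exact/onW_bij/enum_rank_bij.
by apply: eq_bigr => v _; rewrite mul1r.
Qed.

End ZeroSum.
Arguments zero_sum_on F {G} D k j.

Lemma big_support (V : nmodType) (T : finType) (D : pred T) (F : T -> V) :
  (forall v, ~~ D v -> F v = 0) -> \sum_(v | D v) F v = \sum_v F v.
Proof.
move=> F0; rewrite big_mkcond; apply: eq_bigr => v _.
by case: (boolP (D v)) => // /F0.
Qed.

(** * Counting the eigenvalues at the two ends of the spectrum *)

Section Counting.
Variables (R : realType) (G : sgraph).
Variables (r : 'I_#|G| -> R) (P : 'M[R[i]]_#|G|).
Hypothesis unitP : P \is unitarymx.
Hypothesis defL : map_mx (real_complex R) (dist_laplacian R G) =
  P^t* *m diag_mx (\row_i (r i)%:C) *m P.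

(* Vectors that are constant on the components of the complement: in the form
   every distance at least 2 is multiplied by 0. *)
Lemma num_components_compl_le :
  (num_components (compl_graph G) <= #|[pred i | (r i <= #|G|%:R)%R]|)%N.
Proof.
pose e := @compl_adj G; pose rt := fingraph.root e.
have symc : connect_sym e by apply/sym_connect_sym/compl_adj_sym.
(* One equation per vertex that is not the root of its component, so the number of conditions is
   [#|G|] minus the number of components. *)
pose f (k : {v : G | rt v != v}) (j : 'I_#|G|) : R[i] :=
  (j == enum_rank (val k))%:R - (j == enum_rank (rt (val k)))%:R.
have := card_nonneg_form unitP defL (f := f) (e := -1) (c := #|G|%:R).
set q := (X in (_ <= _ + X)%N); have -> : q = #|[pred i | (r i <= #|G|%:R)%R]|.
  by apply: eq_card => i; rewrite !inE mulN1r addrC subr_ge0.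
rewrite card_sig => bound.
suff le_card : (#|G| <= #|[pred v | rt v != v]|
    + #|[pred i | (r i <= #|G|%:R)%R]|)%N.
  have -> : num_components (compl_graph G) = #|fingraph.roots e|.
    by apply: eq_card => v; rewrite !inE andbT.
  have := cardC (fingraph.roots e).
  have -> : #|[predC fingraph.roots e]| = #|[pred v | rt v != v]|.
    exact: eq_card.
  by move: le_card; lia.
apply: bound => x fx0.
set z := fun u => x 0 (enum_rank u).
have zrt v : z v = z (rt v).
  have [-> //|rtv] := eqVneq (rt v) v.
  have := fx0 (exist _ v rtv); rewrite /f /=.
  under eq_bigr do rewrite mulrBl.
  by rewrite sumrB !sum_delta_row => /subr0_eq.
have zconst u v : u != v -> ~~ adj u v -> z u = z v.
  move=> uv nuv; rewrite zrt [RHS]zrt; congr z; apply/(fingraph.rootP symc).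
  by apply: connect1; rewrite /e /compl_adj uv.
rewrite rmorphN rmorph1 mulN1r rmorph_nat addrC subr_ge0.
rewrite -(ler_pMn2r (n := 2)) // dist_laplacian_form sqnorm_enum_rank.
(* All distances may be replaced by 1, so the form becomes that of the complete graph, at most
   [#|G|] times the squared norm. *)
rewrite (eq_bigr (fun u => \sum_v `|z u - z v| ^+ 2)) => [|u _].
  by rewrite (sum_sqr_diff predT z) gerBl mulrn_wge0 ?exprn_ge0.
apply: eq_bigr => v _; rewrite -/(z u) -/(z v).
have [->|uv] := eqVneq u v; first by rewrite subrr normr0 expr0n mulr0.
have [/dist_adj -> |nuv] := boolP (adj u v); first by rewrite mul1r.
by rewrite (zconst u v) // subrr normr0 expr0n mulr0.
Qed.

(** The [+ 1] is the dimension lost to the zero-sum condition. *)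
Lemma independent_card_le (D : pred G) :
    {in D &, forall u v, ~~ adj u v} ->
  (#|D| <= #|[pred i | (#|G|%:R + #|D|%:R <= r i)%R]| + 1)%N.
Proof.
move=> indD.
have := card_nonneg_form unitP defL (f := zero_sum_on R[i] D) (e := 1)
  (c := - (#|G|%:R + #|D|%:R)).
set q := (X in (_ <= _ + X)%N).
have -> : q = #|[pred i | (#|G|%:R + #|D|%:R <= r i)%R]|.
  by apply: eq_card => i; rewrite !inE mul1r subr_ge0.
set p := (X in (_ <= X + _)%N) => bound.
suff le_card : (#|G| <= p + #|[pred i | (#|G|%:R + #|D|%:R <= r i)%R]|)%N.
  by move: le_card; have := card_zero_sum_on D; rewrite -/p; lia.
apply: bound => x fx0; set z := fun u => x 0 (enum_rank u).
have [z0 sumz] : (forall v, ~~ D v -> z v = 0) /\ \sum_v z v = 0.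
  exact: zero_sum_onP.
rewrite rmorph1 mul1r rmorphN (rmorphD _ #|G|%:R) !rmorph_nat mulNr subr_ge0.
rewrite -(ler_pMn2r (n := 2)) // dist_laplacian_form sqnorm_enum_rank.
have allE := sum_sqr_diff predT z.
have DE := sum_sqr_diff D z.
rewrite sumz normr0 expr0n mul0rn subr0 in allE.
have sqD0 v : ~~ D v -> `|z v| ^+ 2 = 0.
  by move=> /z0 ->; rewrite normr0 expr0n.
rewrite (big_support z0) (big_support sqD0) sumz in DE.
rewrite normr0 expr0n mul0rn subr0 in DE.
(* The target is now a sum over all pairs plus a sum over pairs in [D]. Pairs are compared one by
   one: weight 2 is needed inside [D], where distinct vertices are at distance at least 2, and
   weight 1 elsewhere. *)
rewrite mulrDl mulrnDl -allE -DE [X in _ + X]big_mkcond -big_split /=.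
apply: ler_sum => u _.
rewrite [X in _ + (if _ then X else _)]big_mkcond /=.
have [Du|_] := boolP (D u); last first.
  rewrite addr0; apply: ler_sum => v _; rewrite -/(z u) -/(z v).
  have [->|uv] := eqVneq u v; first by rewrite subrr normr0 expr0n mulr0.
  by rewrite ler_peMl ?exprn_ge0 // ler1n dist_ge1.
rewrite -big_split /=; apply: ler_sum => v _; rewrite -/(z u) -/(z v).
have [->|uv] := eqVneq u v.
  by rewrite subrr normr0 expr0n mulr0 /=; case: ifP; rewrite addr0.
case: ifP => Dv.
  rewrite -mulr2n -[leLHS]mulr_natl ler_wpM2r ?exprn_ge0 //.
  by rewrite ler_nat dist_ge2 ?indD.
by rewrite addr0 ler_peMl ?exprn_ge0 // ler1n dist_ge1.
Qed.

End Counting.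

(** As [0 < b <= #|D|], the ranges up to [#|G|], strictly between [#|G|] and [#|G| + b], and from
    [#|G| + #|D|] on are disjoint, so their counts add up to at most [#|G|]. *)
Lemma mDL_independent_le (R : realType) (G : sgraph) (D : pred G) (b : R) :
    {in D &, forall u v, ~~ adj u v} -> 0 < b <= #|D|%:R ->
  (mDL G `](#|G|%:R : R), (#|G|%:R + b)[%R
     + num_components (compl_graph G) + #|D| <= #|G| + 1)%N.
Proof.
move=> indD /andP[b_gt0 leb].
have [r [P [unitP defL ->]]] := dist_laplacian_spectral R G.
have := num_components_compl_le unitP defL.
have := independent_card_le unitP defL indD.
set low := #|[pred i | (r i <= _)%R]|; set mid := #|[pred i | r i \in _]|.
set high := #|[pred i | (_ <= r i)%R]|.
suff : (mid + low + high <= #|G|)%N by lia.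
have cardE (Q : pred 'I_#|G|) : #|Q| = (\sum_i Q i)%N.
  rewrite -sum1_card big_mkcond; apply: eq_bigr => i _.
  by rewrite unfold_in; case: (Q i).
rewrite -[leqRHS]card_ord /mid /low /high !cardE -!big_split /=.
apply: leq_sum => i _ /=; rewrite in_itv /=.
have lt_high : (#|G|%:R + #|D|%:R <= r i)%R -> (#|G|%:R + b <= r i)%R.
  by apply: le_trans; rewrite lerD2l.
case: (boolP (#|G|%:R + #|D|%:R <= r i)%R) => [/lt_high high_i|_].
  rewrite [(r i < _)%R]ltNge high_i andbF /=.
  case: (boolP (r i <= #|G|%:R)%R) => // low_i.
  move: (le_trans high_i low_i); rewrite gerDl => /(lt_le_trans b_gt0).
  by rewrite ltxx.
by case: (leP (r i) #|G|%:R) => _ /=; case: (r i < _)%R.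
Qed.

(** * Color classes and the upper bound *)

Lemma colorable_chromatic (G : sgraph) : colorable G (chromatic_number G).
Proof. by rewrite /chromatic_number; case: ex_minnP. Qed.

Lemma chromatic_gt0 (G : sgraph) : (0 < #|G|)%N -> (0 < chromatic_number G)%N.
Proof.
have /existsP[c _] := colorable_chromatic G.
by move=> /card_gt0P[v _]; case: (c v) => i; exact: leq_trans.
Qed.

Lemma large_color_class (R : realType) (G : sgraph) : (0 < #|G|)%N ->
  exists2 D : pred G,
    {in D &, forall u v, ~~ adj u v} & ceil_n_chi R G <= #|D|%:Z.
Proof.
move=> G_gt0; have k_gt0 := chromatic_gt0 G_gt0; rewrite /ceil_n_chi.
have /existsP[c /forallP col] := colorable_chromatic G.
move: (chromatic_number G) k_gt0 c col => k k_gt0 c col.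
have /card_gt0P[v0 _] := G_gt0.
pose D0 (a : 'I_k) := [pred v | c v == a].
(* A largest color class is chosen by pigeonhole; the color of [v0] shows that there is a color at
   all. *)
case: (@arg_maxnP _ (c v0) predT (fun a => #|D0 a|)) => // a _ maxa.
exists (D0 a).
  move=> u v /eqP cu /eqP cv; apply/negP => uv.
  by have /forallP/(_ v)/implyP/(_ uv) := col u; rewrite cu cv eqxx.
rewrite ceil_le_int ler_pdivrMr ?ltr0n // -natrM ler_nat.
apply: (@leq_trans (\sum_(a' < k) #|D0 a|)%N).
  rewrite -[leqLHS]sum1_card (partition_big c predT) //=.
  by apply: leq_sum => a' _; rewrite sum1_card; exact: maxa.
by rewrite sum_nat_const card_ord mulnC.
Qed.

Lemma mDL_chromatic_le (R : realType) (G : sgraph) : (0 < #|G|)%N ->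
  (mDL G `](#|G|%:R : R), (#|G|%:R + (ceil_n_chi R G)%:~R)[)%:Z <=
  #|G|%:Z - ceil_n_chi R G - (num_components (compl_graph G))%:Z + 1.
Proof.
move=> G_gt0; have [D indD leD] := large_color_class R G_gt0.
have ceil_gt0 : 0 < ceil_n_chi R G.
  by rewrite ceil_gt0 divr_gt0 ?ltr0n ?chromatic_gt0.
have := mDL_independent_le (R := R) (b := (ceil_n_chi R G)%:~R) indD.
rewrite ltr0z ceil_gt0 -[#|D|%:R]/(#|D|%:Z%:~R) ler_int leD => /(_ isT).
by move: leD; set x := mDL _ _; move: x (ceil_n_chi R G) => x c; lia.
Qed.

(** * Complete multipartite graphs and the bipartite example *)

Section CompleteMultipartiteFacts.
Variable s : seq nat.
Hypothesis s_gt0 : forall i : 'I_(size s), (0 < nth 0 s i)%N.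
Let G := complete_multipartite s.

Let rep (i : 'I_(size s)) : G :=
  Tagged (fun i : 'I_(size s) => 'I_(nth 0%N s i)) (Ordinal (s_gt0 i)).

Lemma card_complete_multipartite : #|G| = sumn s.
Proof.
rewrite card_tagged sumnE big_map big_enum sumnE (big_nth 0%N) big_mkord.
by apply: eq_bigr => i _; rewrite card_ord.
Qed.

Lemma card_part (i : 'I_(size s)) : #|[pred v : G | tag v == i]| = nth 0%N s i.
Proof.
pose T_ (i : 'I_(size s)) := 'I_(nth 0%N s i).
have injT : injective (@Tagged _ i T_).
  by move=> a b /eqP; rewrite -tag_eqE /tag_eq /= eqxx tagged_asE => /eqP.
rewrite -[RHS]card_ord -(card_image injT); apply: eq_card => v.
rewrite inE; apply/eqP/imageP => [|[a _ ->]] //.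
by case: v => j a /= <-; exists a.
Qed.

(** The complement is a disjoint union of cliques, one on each part. *)
Lemma connect_compl_multipartite (u v : G) :
  connect (@compl_adj G) u v = (tag u == tag v).
Proof.
apply/idP/idP => [|tuv]; last first.
  have [->|uv] := eqVneq u v; first exact: connect0.
  by apply: connect1; rewrite /compl_adj uv /= /cm_adj negbK.
have clos : closed (@compl_adj G) [pred w : G | tag u == tag w].
  by move=> x y /andP[_ /negPn/eqP xy]; rewrite !inE xy.
by move=> /(closed_connect clos); rewrite !inE eqxx.
Qed.

Lemma num_components_compl_multipartite :
  num_components (compl_graph G) = size s.
Proof.
have symc : connect_sym (@compl_adj G) by apply/sym_connect_sym/compl_adj_sym.
pose f i := fingraph.root (@compl_adj G) (rep i).
have tagf i : tag (f i) = i.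
  apply/eqP; rewrite eq_sym -[i in i == _]/(tag (rep i)).
  by rewrite -connect_compl_multipartite connect_root.
have injf : injective f by move=> i j /(congr1 tag); rewrite !tagf.
rewrite -[RHS]card_ord -(card_image injf); apply: eq_card => v.
rewrite !inE andbT; apply/eqP/imageP => [rv|[i _ ->]]; last exact: root_root.
exists (tag v) => //; rewrite -rv; apply/(fingraph.rootP symc).
by rewrite connect_compl_multipartite rv.
Qed.

(** The parts form a proper coloring, and one representative from each part gives a clique, whose
    colors are distinct. *)
Lemma chromatic_multipartite : chromatic_number G = size s.
Proof.
rewrite /chromatic_number; case: ex_minnP => k /existsP[c /forallP col] mink.
apply/eqP; rewrite eqn_leq; apply/andP; split.
  apply: mink; apply/existsP; exists [ffun v : G => tag v].
  by apply/forallP=> u; apply/forallP=> v; rewrite !ffunE; exact/implyP.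
rewrite -[leqLHS]card_ord -[leqRHS]card_ord.
apply: (@leq_card _ _ (fun i => c (rep i))) => i j cij.
apply: contraTeq isT => nij; have /forallP/(_ (rep j))/implyP := col (rep i).
by rewrite cij eqxx => /(_ nij).
Qed.

Lemma multipartite_connected : (1 < size s)%N -> connected_graph G.
Proof.
move=> s_gt1; split.
  by apply/card_gt0P; exists (rep (Ordinal (ltnW s_gt1))).
move=> u v; have [tuv|] := eqVneq (tag u) (tag v); last exact: connect1.
have [j ju] : exists j, tag u != j.
  have [u0|] := eqVneq (tag u) (Ordinal s_gt1); last by exists (Ordinal s_gt1).
  by exists (Ordinal (ltnW s_gt1)); rewrite u0.
apply: (@connect_trans _ _ (rep j)); apply: connect1 => //.
by rewrite /= /cm_adj /= -tuv eq_sym.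
Qed.

Lemma multipartite_not_complete (i : 'I_(size s)) : (1 < nth 0 s i)%N ->
  ~ graph_iso G (complete_graph #|G|).
Proof.
rewrite -card_part => /card_gt1P[u [v [/eqP tu /eqP tv uv]]].
move=> [f /bij_inj injf adjf]; have := adjf u v.
by rewrite /= /cm_adj /complete_adj tu tv eqxx (inj_eq injf) uv.
Qed.

(** A vertex of another part [j] is a common neighbor of any two vertices in the part of [u]; the
    doubled boolean covers the distances 0 and 2 together. *)
Lemma dist_multipartite (u v : G) (j : 'I_(size s)) : j != tag u ->
  dist u v = if tag u != tag v then 1%N else (u != v).*2.
Proof.
move=> ju; case: ifPn => [tuv|/negPn tuv]; first exact: dist_adj.
have [->|uv] /= := eqVneq u v; first by rewrite dist_refl.
apply: (@dist_common_neighbor _ _ _ (rep j)) => //=.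
- by rewrite /cm_adj negbK tuv.
- by rewrite /cm_adj eq_sym.
- by rewrite /cm_adj -(eqP tuv).
Qed.

End CompleteMultipartiteFacts.

(* Vectors that are supported on the part of size [m] and have zero sum are
   eigenvectors for [2 * m + 1 + m]. *)
Lemma mDL_bipartite_ge (R : realType) m (b : R) : (0 < m)%N -> m%:R < b ->
  (m <= mDL (complete_multipartite [:: m.+1; m])
          `]((2 * m + 1)%:R : R), ((2 * m + 1)%:R + b)[%R + 1)%N.
Proof.
move=> m_gt0 ltmb; set G := complete_multipartite _.
have s_gt0 (i : 'I_2) : (0 < nth 0%N [:: m.+1; m] i)%N.
  by case: i => [[|[|]]].
have cardG : #|G| = (2 * m + 1)%N.
  by rewrite card_complete_multipartite /=; lia.
rewrite -cardG; have [r [P [unitP defL ->]]] := dist_laplacian_spectral R G.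
pose i0 : 'I_2 := ord0; pose i1 : 'I_2 := ord_max.
pose D : pred G := [pred v | tag v == i1].
have cardD : #|D| = m by rewrite (card_part (i1 : 'I_(size [:: m.+1; m]))).
have tag2 (v : G) : ~~ D v -> tag v = i0.
  by rewrite /D /=; move: (tag v) => [[|[|]]] // i _; apply: val_inj.
have := card_eigenvalue unitP defL (f := zero_sum_on R[i] D)
  (c := #|G|%:R + m%:R).
set p := (X in (_ <= X + _)%N) => bound.
have {}bound : (#|G| <= p + #|[pred i | r i == (#|G|%:R + m%:R)%R]|)%N.
  apply: bound => x fx0; set z := fun u => x 0 (enum_rank u).
  have [z0 sumz] : (forall v, ~~ D v -> z v = 0) /\ \sum_v z v = 0.
    exact: zero_sum_onP.
  apply/rowP=> j; rewrite -[j]enum_valK [RHS]mxE; move: (enum_val j) => u.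
  rewrite dist_laplacian_row -/(z u).
  (* The weights split into the complete graph and a clique on [D]. The larger part also has
     distances 2, but both entries vanish there. *)
  have distE v : (dist u v)%:R * (z u - z v) =
      (z u - z v) + (if D u && D v then z u - z v else 0).
    have [->|uv] := eqVneq u v; first by rewrite subrr mulr0 if_same addr0.
    have [j' jNu] : exists j' : 'I_2, j' != tag u.
      by case: (boolP (D u)) => [/eqP ->|/tag2 ->]; [exists i0|exists i1].
    rewrite (@dist_multipartite [:: m.+1; m] s_gt0 _ _ _ jNu) uv.
    have [Du|Du] := boolP (D u); have [Dv|Dv] := boolP (D v).
    - by rewrite (eqP Du) (eqP Dv) eqxx /= mulr_natl mulr2n.
    - by rewrite (eqP Du) (tag2 v Dv) /= mul1r addr0.
    - by rewrite (eqP Dv) (tag2 u Du) /= mul1r addr0.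
    - by rewrite !z0 // subrr mulr0 addr0.
  under eq_bigr do rewrite -/(z _) distE.
  rewrite big_split sumrB sumz subr0 sumr_const /=.
  have [Du|/z0 ->] := boolP (D u); last by rewrite mul0rn mulr0 big1 ?addr0.
  rewrite /= -big_mkcond sumrB (big_support z0) sumz subr0 sumr_const.
  by rewrite -mulrnDr cardD rmorphD !rmorph_nat -natrD mulr_natl.
(* The eigenvalue [#|G| + m] lies in the open interval because [0 < m < b]. *)
have sub : (#|[pred i | r i == (#|G|%:R + m%:R)%R]| <=
    #|[pred i | r i \in `](#|G|%:R : R), (#|G|%:R + b)[%R]|)%N.
  apply/subset_leq_card/subsetP => i; move=> /eqP ri.
  by rewrite inE /= ri in_itv /= ltrDl ltr0n m_gt0 ltrD2l.
have := card_zero_sum_on D; rewrite -/p.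
move: bound sub; rewrite cardD; lia.
Qed.

(** * Ceilings, and equality in both examples *)

(** The division is cleared in the hypothesis, which also excludes [k = 0]. *)
Lemma ceil_divn (R : realType) (n k c : nat) : (c * k < n <= c.+1 * k)%N ->
  Num.ceil (n%:R / k%:R : R) = c.+1%:Z.
Proof.
case: k => [|k]; first by rewrite !muln0; case: n.
move=> /andP[lo hi]; apply: ceil_def.
have -> : c.+1%:Z - 1 = c%:Z by lia.
rewrite -!pmulrn ltr_pdivlMr ?ltr0n // ler_pdivrMr ?ltr0n //.
by rewrite -!natrM ltr_nat ler_nat lo hi.
Qed.

Theorem theorem2p9 (R : realType) :
  let mult (G : sgraph) : int :=
    (mDL G `](#|G|%:R : R), (#|G|%:R + (ceil_n_chi R G)%:~R)[)%:Z in
  let bound (G : sgraph) : int :=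
    #|G|%:Z - ceil_n_chi R G - (num_components (compl_graph G))%:Z + 1 in
  [/\ forall G : sgraph,
        connected_graph G -> ~ graph_iso G (complete_graph #|G|) ->
        mult G <= bound G,
      forall m : nat, (0 < m)%N ->
        let G := complete_multipartite [:: m.+1; m] in
        [/\ connected_graph G, ~ graph_iso G (complete_graph #|G|),
            #|G| = (2 * m + 1)%N, chromatic_number G = 2%N
          & mult G = bound G]
    & forall n : nat, (3 <= n)%N ->
        let G := complete_multipartite (2%N :: nseq (n - 2) 1%N) in
        [/\ connected_graph G, ~ graph_iso G (complete_graph #|G|),
            #|G| = n, chromatic_number G = (n - 1)%N
          & mult G = bound G]].
Proof.
move=> mult bound; split=> [G [G_gt0 _] _|m m_gt0 G|n n_ge3 G].
- exact: mDL_chromatic_le.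
- have s_gt0 (i : 'I_2) : (0 < nth 0%N [:: m.+1; m] i)%N.
    by case: i => [[|[|]]].
  have cardG : #|G| = (2 * m + 1)%N.
    by rewrite card_complete_multipartite /=; lia.
  have chiG : chromatic_number G = 2%N.
    exact: (@chromatic_multipartite [:: m.+1; m]).
  have compG : num_components (compl_graph G) = 2%N.
    exact: (@num_components_compl_multipartite [:: m.+1; m]).
  have ceilG : ceil_n_chi R G = m.+1%:Z.
    by rewrite /ceil_n_chi chiG cardG; apply: ceil_divn; lia.
  split=> //; first exact: (@multipartite_connected [:: m.+1; m]).
    exact: (@multipartite_not_complete [:: m.+1; m] (ord0 : 'I_2)).
  (* The bound is [(2 * m + 1) - (m + 1) - 2 + 1 = m - 1], which the multiplicity of the eigenvalue
     [#|G| + m] reaches. *)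
  apply/le_anti/andP; split.
    by apply: mDL_chromatic_le; rewrite cardG addn1.
  have := mDL_bipartite_ge (R := R) (b := (ceil_n_chi R G)%:~R) m_gt0.
  rewrite {1}ceilG -pmulrn ltr_nat ltnSn => /(_ isT); rewrite -/G.
  rewrite /mult /bound compG cardG; set x := mDL _ _; rewrite ceilG.
  move: x => x; lia.
- set s := 2%N :: nseq (n - 2) 1%N in G *.
  have sizes : size s = (n - 1)%N by rewrite /= size_nseq; lia.
  have s_gt0 (i : 'I_(size s)) : (0 < nth 0%N s i)%N.
    have : nth 0%N s i \in s by exact: mem_nth.
    by rewrite inE mem_nseq => /orP[/eqP ->|/andP[_ /eqP ->]].
  have cardG : #|G| = n.
    by rewrite card_complete_multipartite /= sumn_nseq; lia.
  have chiG : chromatic_number G = (n - 1)%N.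
    by rewrite (chromatic_multipartite s_gt0).
  have compG : num_components (compl_graph G) = (n - 1)%N.
    by rewrite (num_components_compl_multipartite s_gt0).
  have ceilG : ceil_n_chi R G = 2.
    by rewrite /ceil_n_chi chiG cardG; apply: (@ceil_divn _ _ _ 1); lia.
  split=> //.
    by apply: (multipartite_connected s_gt0); rewrite sizes; lia.
    exact: (@multipartite_not_complete _ (ord0 : 'I_(size s))).
  (* The bound is [n - 2 - (n - 1) + 1 = 0], so equality follows from the upper bound, a
     multiplicity being nonnegative. *)
  have := mDL_chromatic_le R (_ : 0 < #|G|)%N.
  rewrite cardG => /(_ (ltnW (ltnW n_ge3))).
  rewrite /mult /bound compG cardG; set x := mDL _ _; rewrite ceilG.
  move: x => x; lia.
Qed.
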